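(* Let $\mathcal{A}$ be a set of $m$ agents and $\mathcal{B}$ a set of $n$ tasks, $\mathcal A\cap\mathcal B=\emptyset$, $m\ge n\ge 1$, let $\mathcal{G}_b=(\mathcal{V}_b,\mathcal{E}_b)$ be the complete bipartite graph with $\mathcal V_b=\mathcal A\cup\mathcal B$ and $\mathcal E_b=\{\{i,j\}\mid i\in\mathcal A,j\in\mathcal B\}$, and let $w:\mathcal{E}_b\to\mathbb{R}$ be a weight function. Assume the distributed information and communication model described in the context (each agent knows only its incident edges and their weights; agents communicate synchronously over a connected undirected graph $\mathcal{G}_C$ of diameter $D$). Then the algorithm pruneBAP, in the distributed implementation described in the context and started from any maximum cardinality matching (MCM) $\mathcal{M}_0$ of $\mathcal{G}_b$, can be executed in this model, and it obtains a solution of the bottleneck assignment problem: it returns (jointly stored by the agents) an MCM $\mathcal{M}$ of $\mathcal{G}_b$ with $$\max_{e\in\mathcal{M}}w(e)=\min_{\mathcal{M}'\in\mathcal{C}(\mathcal{G}_b)}\max_{e\in\mathcal{M}'}w(e),$$ where $\mathcal{C}(\mathcal{G}_b)$ is the set of all MCMs of $\mathcal{G}_b$.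
   Context: **Pruned edge set.** For an MCM $\mathcal{M}$ of $\mathcal{G}_b$, $\phi(\mathcal{G}_b,\mathcal{M}):=\mathcal{M}\cup\{e\in\mathcal{E}_b\mid w(e)<\max_{e'\in\mathcal{M}}w(e')\}$. **Distributed model.** Each agent $i\in\mathcal{A}$ has access to $\mathcal{E}_i=\{\{i,j\}\mid j\in\mathcal{B}\}$ and to the weights of the edges in $\mathcal{E}_i$. Communication is modelled by a time-invariant, undirected, connected graph $\mathcal{G}_C=(\mathcal{A},\mathcal{E}_C)$ of diameter $D$. All agents share a global clock, and at each discrete time step every agent exchanges local information (incident edges and their weights, or its matched task) with all its neighbours in $\mathcal{G}_C$; agents may also relay information received at earlier time steps. A matching is stored jointly: agent $i$ stores its matched task $m_i$, with $m_i=-1$ if $i$ is free (unmatched), where $-1$ is a symbol not in $\mathcal{A}\cup\mathcal{B}$. **pruneBAP.** Set $\mathcal{M}\leftarrow\mathcal{M}_0$. Repeat: (1) MaxEdge: choose $\bar e=\{\bar i,\bar j\}\in\arg\max_{e\in\mathcal{M}}w(e)$ ($\bar i\in\mathcal{A}$, $\bar j\in\mathcal{B}$). (2) $\bar{\mathcal{E}}\leftarrow\phi(\mathcal{G}_b,\mathcal{M})\setminus\{\bar e\}$ and $\bar{\mathcal{M}}\leftarrow\mathcal{M}\setminus\{\bar e\}$. (3) $\mathcal{M}_\nu\leftarrow\mathrm{AugDFS}(\bar e,\bar{\mathcal{M}},(\mathcal{V}_b,\bar{\mathcal{E}}))$. (4) If $\mathcal{M}_\nu\ne\bar{\mathcal{M}}$,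 set $\mathcal{M}\leftarrow\mathcal{M}_\nu$ and continue; otherwise stop and return $\mathcal{M}$. **AugDFS.** $F\leftarrow\emptyset$ (explored agents); $m_i$ is the task matched to $i$ in $\bar{\mathcal{M}}$ (or $-1$); $\nu_i\leftarrow m_i$ for all $i$; $t\leftarrow\bar j$. Repeat until the search is complete: let $S_t=\{i\in\mathcal{A}\mid i\notin F,\{i,t\}\in\bar{\mathcal{E}}\}$ and, if $S_t\neq\emptyset$, choose some $a^*\in S_t$. - If $S_t=\emptyset$ and $t=\bar j$: the search is complete. - If $S_t=\emptyset$ and $t\ne\bar j$: let $a^*$ be the agent with $m_{a^*}=t$; set $t\leftarrow\nu_{a^*}$, then $\nu_{a^*}\leftarrow m_{a^*}$. - If $S_t\ne\emptyset$ and $m_{a^*}=-1$: set $\nu_{a^*}\leftarrow t$; the search is complete. - Otherwise: $\nu_{a^*}\leftarrow t$, $F\leftarrow F\cup\{a^*\}$, $t\leftarrow m_{a^*}$. Return $\mathcal{M}_\nu=\{\{i,\nu_i\}\mid i\in\mathcal{A},\nu_i\ne-1\}$. **Distributed implementation.** MaxEdge is carried out by max-consensus: each agent holds its best known pair (edge, weight), initially $(\{i,m_i\},w(\{i,m_i\}))$ if matched, and for $D$ time steps replaces it by the pair of largest weight among its own and its neighbours' pairs, ties broken by a fixed deterministic rule (e.g. lowest agent index). In step (2), each agent locally forms $\bar{\mathcal{E}}_i=\{\{i,m_i\}\}\cup\{e\in\mathcal{E}_i\mid w(e)<w(\bar e)\}$ (omitting $\{i,m_i\}$ if $m_i=-1$),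 agent $\bar i$ additionally drops $\bar e$, and agent $\bar i$ is labelled free in $\bar{\mathcal{M}}$. In AugDFS, each agent stores $\nu_i$, whether it has been explored, and a last-in-first-out stack of tasks recording the current vertex $t$; the choice of $a^*$ is made by a consensus (e.g. min-consensus on $w(\{i,t\})$ over $i\in S_t$, with deterministic tie-breaking), and the chosen agent $a^*$ communicates $m_{a^*}$ to all agents. *)

(* Defs.v *)
From mathcomp Require Import all_boot all_order all_algebra.
From mathcomp Require Import constructive_ereal reals.

Set Implicit Arguments.
Unset Strict Implicit.
Unset Printing Implicit Defensive.

Import Order.TTheory GRing.Theory Num.Theory.

Local Open Scope ring_scope.

Definition linear_order (T : Type) (r : rel T) : Prop :=
  [/\ antisymmetric r, transitive r & total r].

Section CommunicationGraph.

Variables (T : finType) (e : rel T).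

(* Length of a shortest path from x to y; #|T| when there is none. *)
Definition graph_dist (x y : T) : nat :=
  find (fun k => [exists p : k.-tuple T, path e x p && (last x p == y)])
       (iota 0 #|T|).

Definition diameter : nat := (\max_(x : T) \max_(y : T) graph_dist x y)%N.

End CommunicationGraph.

(* A bipartite graph on the vertex set A + B is given by its edge set
   E : {set A * B}, the pair (i, j) standing for the edge {i, j}; the complete
   bipartite graph is [set: A * B]. *)
Section Matchings.

Variables (R : realType) (A B : finType).
Implicit Types (E M : {set A * B}).

Definition matching E M : bool :=
  (M \subset E) &&
  [forall e in M, forall f in M, ((e.1 == f.1) || (e.2 == f.2)) ==> (e == f)].

Definition mcm E M : bool :=
  matching E M && [forall M' : {set A * B}, matching E M' ==> (#|M'| <= #|M|)%N].

Variable w : A * B -> R.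

Definition max_weight M : \bar R := (\big[maxe/-oo]_(e in M) (w e)%:E)%E.

Definition pruned E M : {set A * B} :=
  M :|: [set e in E | ((w e)%:E < max_weight M)%E].

(* The task matched to agent i in M; None is the symbol -1. *)
Definition task_of M (i : A) : option B := [pick j | (i, j) \in M].

Definition matching_of (nu : A -> option B) : {set A * B} :=
  [set e | nu e.1 == Some e.2].

End Matchings.

Section PruneBAP.

Variables (R : realType) (A B : finType) (w : A * B -> R).
Implicit Types (E M : {set A * B}) (F : {set A}) (nu : {ffun A -> option B}).

Definition update nu (a : A) (x : option B) :
    {ffun A -> option B} :=
  [ffun i => if i == a then x else nu i].

Definition candidates E F (t : B) : {set A} :=
  [set i | (i \notin F) && ((i, t) \in E)].

(* [search root m E F nu t nu'] : the search that is currently in the state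
   (F, nu, t) may complete with final pointers nu'.  Here root is the task from
   which the search started and m_i is the task matched to i beforehand. *)
Inductive search (root : B) (m : A -> option B) E :
    {set A} -> {ffun A -> option B} -> B -> {ffun A -> option B} -> Prop :=
| SearchFail F nu :
    candidates E F root = set0 -> search root m E F nu root nu
| SearchBacktrack F nu t a t' (nu' : {ffun A -> option B}) :
    candidates E F t = set0 -> t != root -> m a = Some t -> nu a = Some t' ->
    search root m E F (update nu a (m a)) t' nu' -> search root m E F nu t nu'
| SearchFree F nu t a :
    a \in candidates E F t -> m a = None ->
    search root m E F nu t (update nu a (Some t))
| SearchMatched F nu t a t' (nu' : {ffun A -> option B}) :
    a \in candidates E F t -> m a = Some t' ->
    search root m E (a |: F) (update nu a (Some t)) t' nu' ->
    search root m E F nu t nu'.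

Definition AugDFS (ebar : A * B) M E M' : Prop :=
  exists2 nu : {ffun A -> option B},
    search ebar.2 (task_of M) E set0 [ffun i => task_of M i] ebar.2 nu &
    M' = matching_of nu.

Definition MaxEdge M (ebar : A * B) : Prop :=
  ebar \in M /\ forall e, e \in M -> w e <= w ebar.

Definition prune_continues M M' : Prop :=
  exists ebar, [/\ MaxEdge M ebar,
    AugDFS ebar (M :\ ebar) (pruned w [set: A * B] M :\ ebar) M' &
    M' <> M :\ ebar].

Definition prune_returns M : Prop :=
  exists ebar, MaxEdge M ebar /\
    AugDFS ebar (M :\ ebar) (pruned w [set: A * B] M :\ ebar) (M :\ ebar).

(* M t is the value of the variable M of pruneBAP at time t, in an execution
   started from M0 and stopped by time T; one iteration may last several time
   steps, during which the variable is unchanged. *)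
Definition pruneBAP_execution M0 (M : nat -> {set A * B}) (T : nat) : Prop :=
  [/\ M 0%N = M0,
      forall t, (t < T)%N -> M t.+1 = M t \/ prune_continues (M t) (M t.+1),
      prune_returns (M T) &
      forall t, (T <= t)%N -> M t = M T].

End PruneBAP.

Section DistributedModel.

Variables (R : realType) (A B : finType).

(* What agents may exchange: an edge with its weight, or an agent with its
   matched task.  Relayed information is still tagged with its origin. *)
Inductive info : Type :=
| EdgeInfo of A * B * R
| TaskInfo of A * option B.

(* A synchronous distributed algorithm.  An agent i is only given its name i,
   the weights j |-> w (i, j) of its incident edges, its initially matched
   task, the global clock and the messages of its neighbours. *)
Record protocol := Protocol {
  pstate : Type;
  pinit : A -> (B -> R) -> option B -> pstate;
  psend : pstate -> seq info;
  pstep : nat -> A -> (B -> R) -> seq info -> pstate -> pstate;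
  ptask : pstate -> option B;
  phalted : pstate -> bool
}.

Variables (P : protocol) (gC : rel A) (w : A * B -> R) (M0 : {set A * B}).

Fixpoint run (t : nat) (i : A) : pstate P :=
  if t is t'.+1 then
    pstep t' i (fun j => w (i, j))
      (flatten [seq psend (run t' k) | k <- enum A & gC i k]) (run t' i)
  else pinit P i (fun j => w (i, j)) (task_of M0 i).

Definition stored_matching (t : nat) : {set A * B} :=
  matching_of (fun i => ptask (run t i)).

End DistributedModel.

Section DistributedPruneBAP.

Variables (R : realType) (A B : finType).

(* The computation is divided into rounds of D exchanges followed by one local
   computation; all rounds have length D + 1, so that the global clock tells the
   agents where they are in a round.  tie x y means that the edge x is preferred
   to y (or equal to it) when both have the same weight in MaxEdge; sel x y means
   that the weighted edge x = (i, t, w (i, t)) is preferred to y (or equal to it)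
   in the choice of the next agent of the search. *)
Variables (D : nat) (tie : rel (A * B)) (sel : rel (A * B * R)).

(* SelectRound: consensus on the next agent a; AnnounceRound: a announces its
   task; CompareRound: the agents find out whether the search has changed the
   task of some of them. *)
Inductive round : Type :=
| MaxEdgeRound | SelectRound | AnnounceRound | CompareRound | Halted.

Record agent_state := AgentState {
  task : option B;          (* the task of the agent in M *)
  bar_task : option B;      (* its task in M minus its heaviest edge *)
  bar_edges : {set B};      (* its incident edges in the pruned graph *)
  nu : option B;
  explored : bool;
  search_root : option B;   (* the task where the search started *)
  stack : seq B;            (* its top is the current vertex of the search *)
  current_round : round;
  best : option (info R A B)  (* information held in the current round *)
}.

Definition heaviest_first (x y : A * B * R) : bool :=
  (y.2 < x.2) || ((x.2 == y.2) && tie x.1 y.1).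

Definition preferred (r : round) (x y : info R A B) : bool :=
  match r, x, y with
  | MaxEdgeRound, EdgeInfo a, EdgeInfo b => heaviest_first a b
  | SelectRound, EdgeInfo a, EdgeInfo b => sel a b
  | _, _, _ => true
  end.

Definition merge_info (r : round) (y : info R A B) (own : option (info R A B)) :=
  if own is Some x then Some (if preferred r x y then x else y) else Some y.

Definition exchange (inbox : seq (info R A B)) (s : agent_state) : agent_state :=
  let: AgentState m mb E v F rt st r b := s in
  AgentState m mb E v F rt st r (foldr (merge_info r) b inbox).

Section LocalComputation.

Variables (i : A) (wi : B -> R).

Definition start_max_edge (m : option B) : agent_state :=
  AgentState m None set0 None false None [::] MaxEdgeRound
    (if m is Some j then Some (EdgeInfo (i, j, wi j)) else None).

Definition start_select m mb (E : {set B}) v (F : bool) rt (st : seq B) :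
    agent_state :=
  AgentState m mb E v F rt st SelectRound
    (if st is t :: _ then
       if ~~ F && (t \in E) then Some (EdgeInfo (i, t, wi t)) else None
     else None).

Definition start_announce m mb E v F rt st (a : A) : agent_state :=
  AgentState m mb E v F rt st AnnounceRound
    (if i == a then Some (TaskInfo R (i, mb)) else None).

Definition start_compare m mb E v F rt st : agent_state :=
  AgentState m mb E v F rt st CompareRound
    (if v != mb then Some (TaskInfo R (i, v)) else None).

Definition compute (s : agent_state) : agent_state :=
  let: AgentState m mb E v F rt st r b := s in
  match r, b with
  | MaxEdgeRound, Some (EdgeInfo (ibar, jbar, wbar)) =>
      let mb' := if i == ibar then None else m in
      let E' := [set j | ((m == Some j) || (wi j < wbar))
                         && ((i, j) != (ibar, jbar))] in
      start_select m mb' E' mb' false (Some jbar) [:: jbar]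
  | SelectRound, None =>
      if st is t :: st' then
        if rt == Some t then start_compare m mb E v F rt st
        else start_select m mb E (if mb == Some t then mb else v) F rt st'
      else s
  | SelectRound, Some (EdgeInfo (a, _, _)) => start_announce m mb E v F rt st a
  | AnnounceRound, Some (TaskInfo (a, ma)) =>
      if st is t :: _ then
        let v' := if i == a then Some t else v in
        if ma is Some t' then
          start_select m mb E v' ((i == a) || F) rt (t' :: st)
        else start_compare m mb E v' F rt st
      else s
  | CompareRound, Some _ => start_max_edge v
  | CompareRound, None => AgentState m mb E v F rt st Halted None
  | _, _ => s
  end.

End LocalComputation.

Definition distributed_pruneBAP : protocol R A B := {|
  pstate := agent_state;
  pinit := start_max_edge;
  psend := fun s => if best s is Some x then [:: x] else [::];
  pstep := fun t i wi inbox s =>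
    if (t %% D.+1 < D)%N then exchange inbox s else compute i wi s;
  ptask := task;
  phalted := fun s => if current_round s is Halted then true else false
|}.

End DistributedPruneBAP.

(* Main.v *)
(** The search keeps an alternating path from its root to the current task, along
    which nu differs from the old matching.  If it meets a free agent, nu becomes
    a maximum cardinality matching inside the pruned graph without the heaviest
    edge, so the pruned graph shrinks strictly, which bounds the number of
    iterations.  If it fails, backtracking has restored nu, and the explored
    agents F contain all the neighbours of |F| + 1 tasks (the root and the tasks
    matched to F): by Hall's condition no maximum cardinality matching has all
    its edges lighter than the removed one, hence the current one is optimal.

    For the distributed part, D steps of gossip along a connected graph of diameter
    D leave every agent with the same preferred item, so that each round of D + 1
    steps performs exactly one transition of a global state. *)

Require Import Defs.
From mathcomp Require Import all_boot all_order all_algebra.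
From mathcomp Require Import constructive_ereal reals.

Set Implicit Arguments.
Unset Strict Implicit.
Unset Printing Implicit Defensive.

Import Order.TTheory GRing.Theory Num.Theory.

(** * Matchings, task functions and coverage of all tasks *)

Section Matchings.

Variables A B : finType.
Implicit Types (E M : {set A * B}) (i : A) (j : B).

Lemma matchingP E M : reflect
  [/\ {subset M <= E},
      forall i j j', (i, j) \in M -> (i, j') \in M -> j = j' &
      forall i i' j, (i, j) \in M -> (i', j) \in M -> i = i']
  (matching E M).
Proof.
apply: (iffP andP) => [[/subsetP sME /forall_inP inj]|[sME inj1 inj2]].
  split=> // [i j j' Mj Mj'|i i' j Mi Mi'].
    have /forall_inP/(_ _ Mj')/implyP := inj _ Mj.
    by rewrite /= eqxx => /(_ isT)/eqP[].
  have /forall_inP/(_ _ Mi')/implyP := inj _ Mi.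
  by rewrite /= eqxx orbT => /(_ isT)/eqP[].
split; first exact/subsetP.
apply/forall_inP=> -[i j] Mij; apply/forall_inP=> -[i' j'] Mij'; apply/implyP.
case/orP=> /eqP /= eq1; rewrite -{}eq1 in Mij' *.
  by rewrite (inj1 _ _ _ Mij Mij').
by rewrite (inj2 _ _ _ Mij Mij').
Qed.

Lemma task_ofP E M i j :
  matching E M -> (task_of M i == Some j) = ((i, j) \in M).
Proof.
case/matchingP=> _ inj _; rewrite /task_of; case: pickP => [j' Mj'|noM].
  by apply/eqP/idP => [[<-]|/inj/(_ Mj')->].
by rewrite noM.
Qed.

Lemma matching_of_task_of E M : matching E M -> matching_of (task_of M) = M.
Proof. by move=> mM; apply/setP=> -[i j]; rewrite inE (task_ofP _ _ mM). Qed.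

Lemma eq_matching_of (f g : A -> option B) :
  f =1 g -> matching_of f = matching_of g.
Proof. by move=> fg; apply/setP=> e; rewrite !inE fg. Qed.

Lemma task_of_matching_of (f : A -> option B) i : task_of (matching_of f) i = f i.
Proof.
rewrite /task_of; case: pickP => [j|nof]; first by rewrite inE => /eqP.
by case fi: (f i) => [j|] //; have := nof j; rewrite inE /= fi eqxx.
Qed.

Lemma matchingS E E' M M' :
  matching E M -> M' \subset M -> M' \subset E' -> matching E' M'.
Proof.
move=> /matchingP[_ inj1 inj2] /subsetP sM' /subsetP sE'.
apply/matchingP; split=> // [i j j' /sM' Mj /sM' Mj'|i i' j /sM' Mj /sM' Mj'].
  exact: inj1 Mj Mj'.
exact: inj2 Mj Mj'.
Qed.

Lemma card_snd_matching E M : matching E M -> #|[set e.2 | e in M]| = #|M|.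
Proof.
move=> /matchingP[_ _ inj]; apply: card_in_imset => -[i j] [i' j'] Me Me' /= eqj.
by rewrite eqj in Me *; rewrite (inj _ _ _ Me Me').
Qed.

(** The edges of a matching have distinct tasks, so its size is the number of tasks it covers. No
    matching can exceed one that covers all of [B]. *)
Lemma covering_matching_mcm E M :
  matching E M -> (forall j, exists i, (i, j) \in M) -> mcm E M.
Proof.
move=> mM cover; apply/andP; split=> //; apply/forallP=> M'; apply/implyP=> mM'.
rewrite -(card_snd_matching mM') -(card_snd_matching mM) subset_leq_card //.
apply/subsetP=> j _; have [i Mij] := cover j.
by apply/imsetP; exists (i, j).
Qed.

Lemma mcm_complete_cover M j :
  #|B| <= #|A| -> mcm setT M -> exists i, (i, j) \in M.
Proof.
move=> leBA /andP[mM /forallP maxM].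
(* Pairing the tasks with agents of the same enumeration rank gives a matching [M1] of size [#|B|];
   maximality of [M] then forces it to cover [#|B|] tasks. *)
pose f (j : B) : A := enum_val (widen_ord leBA (enum_rank j)).
have f_inj : injective f.
  by move=> x y /enum_val_inj/(congr1 val)/= /ord_inj/enum_rank_inj.
pose M1 := [set (f j, j) | j in B].
have mM1 : matching setT M1.
  apply/matchingP; split=> [e _|i j1 j2|i i' j1]; first by rewrite inE.
    by case/imsetP=> k _ [-> ->] /imsetP[k' _ [/f_inj -> ->]].
  by case/imsetP=> k _ [-> ->] /imsetP[k' _ [-> ->]].
have cM1 : #|M1| = #|B| by rewrite card_imset // => x y [].
have /eqP covM : [set e.2 | e in M] == setT.
  rewrite eqEcard subsetT cardsT (card_snd_matching mM) -cM1.
  by have /implyP := maxM M1; apply.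
have /imsetP[[i j'] Mij ->] : j \in [set e.2 | e in M] by rewrite covM inE.
by exists i.
Qed.

End Matchings.

(** * The depth-first search: alternating path, augmentation and Hall violators *)

Section Search.

Variables (A B : finType) (root : B) (m : A -> option B) (E : {set A * B}).
Implicit Types (F : {set A}) (nu : {ffun A -> option B}) (t : B) (st : seq B).

Hypothesis m_inj : forall a a' j, m a = Some j -> m a' = Some j -> a = a'.
Hypothesis m_root : forall a, m a <> Some root.
Hypothesis m_cover : forall j, j != root -> exists a, m a = Some j.
Hypothesis m_edge : forall a j, m a = Some j -> (a, j) \in E.

(* [chain t st nu]: the current vertex t and the tasks st below it form the
   alternating path from t back to root along which nu differs from m. *)
Inductive chain : B -> seq B -> {ffun A -> option B} -> Prop :=
| ChainRoot : chain root [::] [ffun i => m i]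
| ChainPush t st nu a t' :
    chain t st nu -> (a, t) \in E -> nu a = m a -> m a = Some t' ->
    chain t' (t :: st) (update nu a (Some t)).

(** [C] is the set of tasks currently assigned by [nu]: all but the current vertex while the search
    runs, and all tasks after an augmentation. *)
Definition partial_bijection nu (C : pred B) : Prop :=
  [/\ forall i i' j, nu i = Some j -> nu i' = Some j -> i = i',
      forall i j, nu i = Some j -> (i, j) \in E,
      forall i j, nu i = Some j -> C j &
      forall j, C j -> exists i, nu i = Some j].

Lemma chain_partial_bijection t st nu :
  chain t st nu -> partial_bijection nu (predC1 t).
Proof.
elim=> {t st nu} [|t st nu a t' _ [inj edge range cover] Eat nua ma].
  split=> [i i' j|i j|i j|j /m_cover[a ma]]; rewrite ?ffunE //.
  - exact: m_inj.
  - exact: m_edge.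
  - by move=> mi; apply/eqP=> jr; case: (@m_root i); rewrite -jr.
  - by exists a; rewrite ffunE.
(* A push moves [a] from [t'] to [t]: the missing task [t] becomes assigned and [t'] becomes the
   missing one. They differ because [nu] never points to [t]. *)
rewrite ma in nua; have /= t't := range _ _ nua.
split=> [i i' j|i j|i j|j /= jt'].
- rewrite !ffunE; have [->|_] := eqVneq i a; have [->|_] := eqVneq i' a => //.
  + by move=> [<-] /range/=; rewrite eqxx.
  + by move=> nui [jt]; have := range _ _ nui; rewrite -jt /= eqxx.
  + exact: inj.
- by rewrite ffunE; have [->|_] := eqVneq i a; [move=> [<-] | apply: edge].
- rewrite ffunE /=; have [_|ia nui] := eqVneq i a.
    by move=> [<-]; rewrite eq_sym.
  by apply: contraNneq ia => jt'; rewrite -{}jt' in nua; rewrite (inj _ _ _ nui nua).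
- have [->|jt] := eqVneq j t; first by exists a; rewrite ffunE eqxx.
  have [i nui] := cover _ jt; exists i; rewrite ffunE; case: eqVneq nui => // ->.
  by rewrite nua => -[jj]; rewrite jj eqxx in jt'.
Qed.

(** Only [t] was missing, and an unassigned agent takes it without releasing any other task. *)
Lemma chain_augment t st nu a :
  chain t st nu -> nu a = None -> (a, t) \in E ->
  partial_bijection (update nu a (Some t)) predT.
Proof.
move=> /chain_partial_bijection[inj edge range cover] nua Eat.
split=> // [i i' j|i j|j _].
- rewrite !ffunE; have [->|_] := eqVneq i a; have [->|_] := eqVneq i' a => //.
  + by move=> [<-] /range/=; rewrite eqxx.
  + by move=> nui [jt]; have := range _ _ nui; rewrite -jt /= eqxx.
  + exact: inj.
- by rewrite ffunE; have [->|_] := eqVneq i a; [move=> [<-] | apply: edge].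
- have [->|jt] := eqVneq j t; first by exists a; rewrite ffunE eqxx.
  have [i nui] := cover _ jt; exists i; rewrite ffunE.
  by case: eqVneq nui => // ->; rewrite nua.
Qed.

(** Every pushed vertex is the old task of some agent, and [root] is nobody's old task. A search
    that fails at [root] has therefore restored all pointers. *)
Lemma chain_root st nu : chain root st nu -> st = [::] /\ nu = [ffun i => m i].
Proof.
move eqt: root => t c; case: c eqt => // t' st' nu' a t'' _ _ _ ma eqt.
by case: (@m_root a); rewrite ma eqt.
Qed.

(** By injectivity of [m], the agent whose old task is [t] is the one that was pushed last, so
    backtracking through it undoes exactly the last push. *)
Lemma chain_pop t st nu a :
  chain t st nu -> t != root -> m a = Some t ->
  exists t' st', [/\ st = t' :: st', nu a = Some t' &
                     chain t' st' (update nu a (m a))].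
Proof.
case=> [|t' st' nu' a' t'' c Ea nua ma' _ ma]; first by rewrite eqxx.
rewrite {ma}(m_inj ma ma'); exists t', st'; split=> //.
  by rewrite ffunE eqxx.
rewrite (_ : update _ _ _ = nu') //; apply/ffunP=> i; rewrite !ffunE.
by case: eqVneq => // ->; rewrite nua.
Qed.

(** An explored agent with [nu a <> m a] lies on the current path. One with [nu a = m a] has been
    backtracked from, so its task has no unexplored neighbour left. *)
Definition search_invariant F nu : Prop :=
  (forall a, a \notin F -> nu a = m a) /\
  (forall a, a \in F -> exists s, m a = Some s /\
     (nu a = m a -> candidates E F s = set0)).

Lemma search_invariant0 : search_invariant set0 [ffun i => m i].
Proof. by split=> a; rewrite ?ffunE ?inE. Qed.

Lemma search_invariant_backtrack F nu t a :
  search_invariant F nu -> candidates E F t = set0 -> m a = Some t ->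
  search_invariant F (update nu a (m a)).
Proof.
move=> [out inF] c0 ma; split=> i; rewrite ffunE.
  by case: eqVneq => [->|_ /out].
case: eqVneq => [->|_ /inF//] _; by exists t.
Qed.

Lemma search_invariant_explore F nu st t a t' :
  chain t st nu -> search_invariant F nu -> a \in candidates E F t ->
  m a = Some t' ->
  search_invariant (a |: F) (update nu a (Some t)).
Proof.
move=> c [out inF]; rewrite inE => /andP[aF Eat] ma; split=> i.
  by rewrite !inE ffunE negb_or => /andP[/negPf-> /out].
rewrite !inE ffunE; case: eqVneq => [-> _|_ /= /inF[s [ms c0]]].
  (* The new pointer of [a] cannot equal [m a]: [a] was unexplored, so [nu a = m a] would be the
     current vertex [t], which [nu] avoids. *)
  exists t'; split=> // tm; have := out _ aF; rewrite -tm.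
  have [_ _ range _] := chain_partial_bijection c.
  by move=> /range/=; rewrite eqxx.
(* Enlarging [F] can only shrink a set of candidates. *)
exists s; split=> // /c0 {}c0; apply/setP=> k; have /setP/(_ k) := c0.
rewrite !inE; case: (k \in F) => //=; first by rewrite orbT.
by move=> ->; rewrite andbF.
Qed.

(* The |F| + 1 tasks consisting of root and the tasks matched to F have no
   neighbour outside F. *)
Definition hall_violator F : Prop :=
  candidates E F root = set0 /\
  forall a, a \in F -> exists s, m a = Some s /\ candidates E F s = set0.

(** Induction on the search, carrying the path and the invariant. On failure at [root] every pointer
    equals its old value, so the invariant makes each explored task a dead end and [F] is a Hall
    violator. *)
Lemma search_outcome F nu t nu' st :
  search root m E F nu t nu' -> chain t st nu -> search_invariant F nu ->
  partial_bijection nu' predT \/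
  (nu' = [ffun i => m i] /\ exists F', hall_violator F').
Proof.
move=> s; elim: s st => {F nu t nu'}.
- move=> F nu c0 st c inv; right; have [_ nuE] := chain_root c; split=> //.
  exists F; split=> // a /(inv.2)[s [ma c1]]; exists s; split=> //; apply: c1.
  by rewrite nuE ffunE.
- move=> F nu t a t' nu' c0 tr ma nua _ IH st c inv.
  have [t1 [st' [_ nua' c']]] := chain_pop c tr ma.
  have tt1 : t' = t1 by move: nua'; rewrite nua => -[].
  rewrite -{}tt1 in c'.
  exact: IH c' (search_invariant_backtrack inv c0 ma).
- move=> F nu t a aC ma st c [out _]; left; move: aC; rewrite inE => /andP[aF Eat].
  by apply: chain_augment c _ Eat; rewrite out.
- move=> F nu t a t' nu' aC ma _ IH st c inv.
  apply: IH (search_invariant_explore c inv aC ma).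
  move: aC; rewrite inE => /andP[aF Eat].
  by apply: ChainPush c Eat _ ma; rewrite inv.1.
Qed.

(** Pigeonhole: a covering matching would send the [#|F| + 1] tasks of [T] injectively into [F]. *)
Lemma hall_violator_uncovered F M :
  hall_violator F -> matching E M -> ~ forall j, exists i, (i, j) \in M.
Proof.
move=> [c0 cF] /matchingP[sME inj1 inj2] cover.
have [a0 _] := cover root.
(* The default [root] is never taken on [F], where [m] is defined; likewise [a0] is only the default
   that makes [g] total. *)
pose h a := odflt root (m a).
have hE a : a \in F -> m a = Some (h a).
  by move=> /cF[s [ma _]]; rewrite /h ma.
pose T := root |: h @: F.
have cT : #|T| = #|F|.+1.
  rewrite cardsU1 card_in_imset; last first.
    by move=> a a' /hE ma /hE ma' haa'; apply: (m_inj ma); rewrite ma' haa'.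
  rewrite (_ : root \notin _) //; apply/imsetP=> -[a /hE + rE]; rewrite -rE.
  exact: m_root.
pose g j := odflt a0 [pick i | (i, j) \in M].
have gM j : (g j, j) \in M.
  rewrite /g; case: pickP => [i|noM] //=; have [i] := cover j; by rewrite noM.
have gT : g @: T \subset F.
  apply/subsetP=> _ /imsetP[j jT ->]; apply: contraT => gF.
  have cj : candidates E F j = set0.
    move: jT; rewrite !inE => /orP[/eqP->//|/imsetP[a aF ->]].
    have [s [ma <-]] := cF _ aF; congr candidates; have := hE _ aF.
    by rewrite ma => -[].
  by have := in_set0 (g j); rewrite -cj inE gF sME.
have := subset_leq_card gT; rewrite card_imset ?cT ?ltnn // => j j' gj.
by apply: inj1 (gM j) _; rewrite gj.
Qed.

Lemma partial_bijection_mcm nu :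
  partial_bijection nu predT -> mcm setT (matching_of nu).
Proof.
move=> [inj edge _ cover]; apply: covering_matching_mcm.
  apply/matchingP; split=> [e _|i j j'|i i' j]; rewrite !inE //=.
    by move=> /eqP-> /eqP[].
  by move=> /eqP mi /eqP; apply: inj.
by move=> j; have [//|i nui] := cover j; exists i; rewrite inE nui.
Qed.

End Search.

(** * One iteration of pruneBAP: progress and optimality *)

Section PruneBAPCorrectness.

Variables (R : realType) (A B : finType) (w : A * B -> R).
Hypothesis leBA : #|B| <= #|A|.
Implicit Types (M : {set A * B}) (e : A * B).

Lemma MaxEdge_max_weight M e : MaxEdge w M e -> max_weight w M = (w e)%:E.
Proof.
move=> [Me max_e]; apply/eqP; rewrite eq_le; apply/andP; split.
  by apply: bigmax_le => [|f /max_e]; rewrite ?leNye ?lee_fin.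
exact: (le_bigmax_cond _ (fun e => (w e)%:E)).
Qed.

Lemma mem_pruned M e f :
  MaxEdge w M e -> (f \in pruned w setT M :\ e) =
    ((f \in M) || (w f < w e)%R) && (f != e).
Proof.
by move=> /MaxEdge_max_weight maxM; rewrite !inE maxM lte_fin andbC.
Qed.

(** Provides what the search analysis assumes of the old matching: without [e], the matching misses
    exactly the task [e.2], which serves as the root. *)
Lemma mcmD1 M e : mcm setT M -> e \in M ->
  let m := task_of (M :\ e) in
  [/\ matching setT (M :\ e),
      forall a a' j, m a = Some j -> m a' = Some j -> a = a',
      forall a, m a <> Some e.2,
      forall j, j != e.2 -> exists a, m a = Some j &
      forall a j, m a = Some j -> (a, j) \in M :\ e].
Proof.
move=> mcmM Me m; have /andP[mM _] := mcmM.
have mMe : matching setT (M :\ e).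
  by apply: matchingS mM _ _; rewrite ?subD1set ?subsetT.
have [_ inj1 inj2] := matchingP _ _ mM.
have mE a j : (m a = Some j) <-> ((a, j) \in M :\ e).
  by rewrite -(task_ofP _ _ mMe); split=> /eqP.
split=> // [a a' j|a|j je|a j /mE //].
- by move=> /mE/setD1P[_ Mj] /mE/setD1P[_ Mj']; apply: inj2 Mj Mj'.
- case: e Me @m mMe mE => i j Me m mMe mE /mE/setD1P[/eqP ne Ma].
  by apply: ne; rewrite (inj2 _ _ _ Ma Me).
- have [a Maj] := mcm_complete_cover j leBA mcmM.
  exists a; apply/mE; rewrite !inE Maj andbT.
  by apply: contraNneq je => <-.
Qed.

Lemma subset_pruned M e : M :\ e \subset pruned w setT M :\ e.
Proof. by apply: setSD; apply: subsetUl. Qed.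

Lemma AugDFS_outcome M e M' :
  mcm setT M -> e \in M ->
  AugDFS e (M :\ e) (pruned w setT M :\ e) M' ->
  (mcm setT M' /\ M' \subset pruned w setT M :\ e) \/
  (M' = M :\ e /\ forall M1, matching setT M1 ->
     (forall j, exists i, (i, j) \in M1) ->
     ~ M1 \subset pruned w setT M :\ e).
Proof.
move=> mcmM Me [nu s ->].
have [mMe m_inj m_root m_cover m_edge] := mcmD1 mcmM Me.
have m_edge' a j (ma : task_of (M :\ e) a = Some j) :
  (a, j) \in pruned w setT M :\ e := subsetP (subset_pruned M e) _ (m_edge _ _ ma).
have := search_outcome m_inj m_root m_cover m_edge' s (ChainRoot _ _ _)
  (search_invariant0 _ _).
case=> [pb|[nuE [F hallF]]]; [left|right].
  split; first exact: partial_bijection_mcm pb.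
  apply/subsetP=> -[i j]; have [_ edge _ _] := pb.
  by rewrite inE => /eqP; apply: edge.
split=> [|M1 mM1 cover sM1].
  rewrite -[RHS](matching_of_task_of mMe); apply: eq_matching_of => i.
  by rewrite nuE ffunE.
by apply: (hall_violator_uncovered m_inj m_root hallF (matchingS mM1 _ sM1) cover).
Qed.

(** The size of the pruned graph is the termination measure. The new matching weighs at most [w e],
    so no edge enters; [e] itself leaves, being neither in [M'] nor strictly lighter than its
    maximum. *)
Lemma prune_continues_mcm M M' :
  mcm setT M -> prune_continues w M M' ->
  mcm setT M' /\ #|pruned w setT M'| < #|pruned w setT M|.
Proof.
move=> mcmM [e [maxe aug neq]]; have Me := maxe.1.
case: (AugDFS_outcome mcmM Me aug) => [[mcmM' sM']|[/neq//]].
split=> //; apply: proper_card; have max_le : (max_weight w M' <= (w e)%:E)%E.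
  apply: bigmax_le => [|f /(subsetP sM')]; rewrite ?leNye // (mem_pruned _ maxe).
  by rewrite lee_fin => /andP[/orP[/maxe.2//|/ltW]].
apply/properP; split.
  apply/subsetP=> f; rewrite !inE => /orP[/(subsetP sM')|].
    by rewrite !inE => /andP[].
  by rewrite (MaxEdge_max_weight maxe) => /lt_le_trans ->; rewrite ?orbT.
exists e; rewrite !inE ?Me // negb_or -leNgt max_le andbT.
by apply: contraL (set11 e) => /(subsetP sM'); rewrite !inE eqxx.
Qed.

(** A strictly better MCM would use only edges lighter than [e], hence would cover all tasks inside
    the graph that was searched, against the failure of the search. *)
Lemma prune_returns_optimal M :
  mcm setT M -> prune_returns w M ->
  max_weight w M =
    (\big[mine/+oo]_(M' : {set A * B} | mcm setT M') max_weight w M')%E.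
Proof.
move=> mcmM [e [maxe aug]]; have Me := maxe.1.
have no_better M1 : mcm setT M1 -> (max_weight w M <= max_weight w M1)%E.
  move=> mcmM1; have /andP[mM1 _] := mcmM1; rewrite leNgt; apply/negP => ltM1.
  case: (AugDFS_outcome mcmM Me aug) => [[mcmM' _]|[_]].
    (* The returned set [M :\ e] leaves [e.2] uncovered, so it is not an MCM and the search cannot
       have augmented. *)
    have [_ _ m_root _ _] := mcmD1 mcmM Me; have /andP[mMe _] := mcmM'.
    have [i Mi] := mcm_complete_cover e.2 leBA mcmM'.
    by apply: (m_root i); apply/eqP; rewrite (task_ofP _ _ mMe).
  move=> /(_ _ mM1); apply=> [j|]; first exact: mcm_complete_cover.
  apply/subsetP=> f M1f; rewrite (mem_pruned _ maxe).
  have : (w f < w e)%R.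
    rewrite -lte_fin -(MaxEdge_max_weight maxe); apply: le_lt_trans ltM1.
    exact: (le_bigmax_cond _ (fun e => (w e)%:E)).
  by move=> fe; rewrite fe orbT; apply: contraTneq fe => ->; rewrite ltxx.
apply/eqP; rewrite eq_le; apply/andP; split.
  by apply: le_bigmin => //; apply: leey.
exact: bigmin_le_cond.
Qed.

End PruneBAPCorrectness.

(** * Gossip: the diameter bound and consensus *)

Lemma connect_path_diameter (T : finType) (e : rel T) x y :
  connect e x y ->
  exists p, [/\ path e x p, last x p = y & size p <= diameter e].
Proof.
move=> /connectP[p0 /shortenP[p ep Up _] ->].
set P := fun k => [exists q : k.-tuple T, path e x q && (last x q == last x p)].
(* A duplicate-free path has fewer than [#|T|] edges, so [find] succeeds within the range and
   [graph_dist] is the length of an actual path. *)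
have hasP : has P (iota 0 #|T|).
  apply/hasP; exists (size p).
    by rewrite mem_iota /= add0n (leq_trans _ (max_card (mem (x :: p)))) ?(card_uniqP Up).
  by apply/existsP; exists (in_tuple p); rewrite /= ep eqxx.
have lt_find : find P (iota 0 #|T|) < #|T|.
  by move: hasP; rewrite has_find size_iota.
have := nth_find 0 hasP; rewrite nth_iota // add0n => /existsP[q /andP[eq_ /eqP lq]].
exists q; split=> //.
rewrite size_tuple -/(graph_dist e x (last x p)) /diameter.
apply: leq_trans (leq_bigmax x).
exact: (leq_bigmax (F := graph_dist e x) (last x p)).
Qed.

Section Gossip.

Variables (R : realType) (A B : finType).
Variables (tie : rel (A * B)) (sel : rel (A * B * R)) (gC : rel A).
Variable r : round.

Local Notation info := (info R A B).
Local Notation pref := (preferred tie sel r).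
Local Notation merge := (merge_info tie sel r).

Definition outbox (b : option info) : seq info := if b is Some x then [:: x] else [::].

Variable b0 : A -> option info.

Fixpoint gossip (t : nat) (i : A) : option info :=
  if t is t'.+1 then
    foldr merge (gossip t' i)
      (flatten [seq outbox (gossip t' k) | k <- enum A & gC i k])
  else b0 i.

Lemma merge_origin own (b : A -> option info) (s : seq A) x :
  foldr merge own (flatten [seq outbox (b k) | k <- s]) = Some x ->
  own = Some x \/ exists2 k, k \in s & b k = Some x.
Proof.
elim: s => [|k s IH] /=; first by left.
rewrite foldr_cat; set acc := foldr _ _ (flatten _) in IH *.
have {}IH : acc = Some x -> own = Some x \/ exists2 l, l \in k :: s & b l = Some x.
  by move=> /IH[|[l ls bl]]; [left | right; exists l; rewrite ?in_cons ?ls ?orbT].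
case bk: (b k) => [y|] //=.
case: acc IH => [z|_] /=; last by move=> [<-]; right; exists k; rewrite ?mem_head.
case: ifP => // _ _ [<-]; by right; exists k; rewrite ?mem_head.
Qed.

Lemma gossip_origin t i x : gossip t i = Some x -> exists k, b0 k = Some x.
Proof.
elim: t i => [|t IH] i /=; first by exists i.
by move=> /merge_origin[/IH|[k _ /IH]].
Qed.

Lemma gossip_none t i : (forall k, b0 k = None) -> gossip t i = None.
Proof.
move=> none; case g: (gossip t i) => [x|] //.
by have [k] := gossip_origin g; rewrite none.
Qed.

(** [Q] singles out the kind of item that circulates in a round. Items of different kinds are
    preferred to each other both ways, so transitivity can only be asked within one kind. *)
Variable Q : info -> Prop.
Hypothesis b0Q : forall i x, b0 i = Some x -> Q x.
Hypothesis pref_total : forall x y, Q x -> Q y -> pref x y || pref y x.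
Hypothesis pref_trans : forall y x z, Q x -> Q y -> Q z ->
  pref x y -> pref y z -> pref x z.

Lemma pref_refl x : Q x -> pref x x.
Proof. by move=> Qx; have := pref_total Qx Qx; rewrite orbb. Qed.

Lemma merge_dominates own (b : A -> option info) (s : seq A) :
  (forall x, own = Some x -> Q x) -> (forall k x, b k = Some x -> Q x) ->
  (forall y, own = Some y -> exists2 x,
     foldr merge own (flatten [seq outbox (b k) | k <- s]) = Some x & pref x y) /\
  (forall k y, k \in s -> b k = Some y -> exists2 x,
     foldr merge own (flatten [seq outbox (b k) | k <- s]) = Some x & pref x y).
Proof.
move=> ownQ bQ; elim: s => [|k s [IH1 IH2]] /=.
  by split=> // y oy; exists y => //; apply/pref_refl/(ownQ _ oy).
rewrite foldr_cat; have accQ := @merge_origin own b s.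
set acc := foldr _ _ (flatten _) in IH1 IH2 accQ *.
have {}accQ z : acc = Some z -> Q z by move=> /accQ[/ownQ|[l _ /bQ]].
(* Merging one more outbox preserves dominance over [y]: the accumulator survives or yields to an
   item that, by totality, is preferred to it. *)
have keep y : Q y -> (exists2 x, acc = Some x & pref x y) ->
    exists2 x, foldr merge acc (outbox (b k)) = Some x & pref x y.
  move=> Qy [x accx xy]; case bk: (b k) => [z|] /=; last by exists x.
  rewrite accx /=; case: ifP => [_|zx]; first by exists x.
  exists z => //; have [Qx Qz] := (accQ _ accx, bQ _ _ bk).
  by apply: pref_trans xy => //; have := pref_total Qx Qz; rewrite zx.
split=> [y oy|l y]; first by apply: keep; [apply: ownQ oy | apply: IH1].
rewrite in_cons => /predU1P[->|ls] bl; last first.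
  by apply: keep; [apply: bQ bl | apply: IH2 bl].
rewrite bl /=; have Qy := bQ _ _ bl; case: acc accQ {IH1 IH2 keep} => [x|_] /=.
  move=> _; case: ifP => xy; [by exists x | by exists y => //; apply: pref_refl].
by exists y => //; apply: pref_refl.
Qed.

Lemma gossipQ t i x : gossip t i = Some x -> Q x.
Proof. by move=> /gossip_origin[k /b0Q]. Qed.

(** Information crosses one edge per step: the next agent on the path already holds an item at least
    as good as [y] at time [t], and [i] merges it one step later. *)
Lemma gossip_path t i p y :
  path gC i p -> size p <= t -> b0 (last i p) = Some y ->
  exists2 x, gossip t i = Some x & pref x y.
Proof.
elim: t i p => [|t IH] i p.
  by case: p => //= _ _ b0y; exists y => //; apply/pref_refl/b0Q/b0y.
move=> ep sp b0y /=.
have [dom_own dom_in] := merge_dominates [seq k <- enum A | gC i k]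
  (@gossipQ t i) (@gossipQ t).
have Qy := b0Q b0y.
suff [x' [Qx' x'y [x xE xx']]] : exists x', [/\ Q x', pref x' y &
    exists2 x, gossip t.+1 i = Some x & pref x x'].
  exists x; first exact: xE.
  by apply: pref_trans xx' x'y => //; apply: gossipQ xE.
case: p ep sp b0y => [_ _|j p /= /andP[ij ep] sp] b0y.
  have [x' gx' x'y] := IH i [::] isT (leq0n _) b0y.
  by exists x'; split; [apply: gossipQ gx' | | apply: dom_own].
have [x' gx' x'y] := IH j p ep sp b0y.
exists x'; split; [exact: gossipQ gx' | by [] | apply: dom_in gx'].
by rewrite mem_filter ij mem_enum.
Qed.

Hypothesis gC_conn : forall i k, connect gC i k.

Lemma gossip_best k y i : b0 k = Some y ->
  exists2 x, gossip (diameter gC) i = Some x & pref x y.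
Proof.
have [p [ep lp sp]] := connect_path_diameter (gC_conn i k).
by rewrite -lp; apply: gossip_path.
Qed.

(** Every agent ends with an initial item that dominates all initial items; antisymmetry among these
    makes it the same for all. *)
Lemma gossip_consensus k0 y0 : b0 k0 = Some y0 ->
  (forall k k' x y, b0 k = Some x -> b0 k' = Some y ->
     pref x y -> pref y x -> x = y) ->
  exists x, [/\ exists k, b0 k = Some x,
                forall k y, b0 k = Some y -> pref x y &
                forall i, gossip (diameter gC) i = Some x].
Proof.
move=> b0y anti; have [x gx _] := gossip_best k0 b0y.
have best i x' : gossip (diameter gC) i = Some x' ->
    forall k y, b0 k = Some y -> pref x' y.
  by move=> gx' k y /gossip_best-/(_ i)[x'']; rewrite gx' => -[<-].
exists x; split; [exact: gossip_origin gx | exact: best gx | move=> i].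
have [x' gx' _] := gossip_best i b0y; rewrite gx'; congr Some.
have [[k bk] [k' bk']] := (gossip_origin gx, gossip_origin gx').
by apply: (anti _ _ _ _ bk' bk); [apply: best gx' _ _ bk | apply: best gx _ _ bk'].
Qed.

End Gossip.

(** * The protocol: each round as one transition of a global state *)

Section Distributed.

Variables (R : realType) (A B : finType) (w : A * B -> R).
Variables (gC : rel A) (tie : rel (A * B)) (sel : rel (A * B * R)).
Variable M0 : {set A * B}.
Hypothesis B_gt0 : 0 < #|B|.
Hypothesis leBA : #|B| <= #|A|.
Hypothesis gC_conn : forall i k, connect gC i k.
Hypothesis tieP : linear_order tie.
Hypothesis selP : linear_order sel.

Local Notation D := (diameter gC).
Local Notation P := (distributed_pruneBAP D tie sel).
Local Notation state := (agent_state R A B).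
Local Notation run := (run P gC w M0).

Implicit Types (M E : {set A * B}) (F : {set A}) (nu : {ffun A -> option B}).
Implicit Types (e : A * B) (st : seq B) (s : A -> state).

Definition set_best (s : state) (b : option (info R A B)) : state :=
  let: AgentState m mb E v F rt st r _ := s in AgentState m mb E v F rt st r b.

Lemma exchangeE inbox (s : state) :
  exchange tie sel inbox s =
    set_best s (foldr (merge_info tie sel (current_round s)) (best s) inbox).
Proof. by case: s. Qed.

Lemma set_bestE (s : state) b :
  [/\ best (set_best s b) = b, current_round (set_best s b) = current_round s,
      task (set_best s b) = task s &
      forall b', set_best (set_best s b) b' = set_best s b'].
Proof. by case: s. Qed.

Definition at_round (k : nat) s : Prop := forall i, run (k * D.+1) i = s i.

Definition round_result (r : round) s (i : A) : option (info R A B) :=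
  gossip tie sel gC r (fun i => best (s i)) D i.

(** Exchanges touch only the field [best], so the first [D] steps of a round are exactly gossip on
    that field. *)
Lemma run_exchange k r s d i :
  (forall i, current_round (s i) = r) -> at_round k s -> d <= D ->
  run (k * D.+1 + d) i =
    set_best (s i) (gossip tie sel gC r (fun i => best (s i)) d i).
Proof.
move=> rs atk; elim: d i => [|d IH] i dD.
  by rewrite addn0 atk /=; case: (s i).
have {}IH j := IH j (ltnW dD).
rewrite addnS /= modnMDl modn_small ?ltnS ?(ltnW dD) // dD exchangeE IH.
have [-> -> _ ->] := set_bestE (s i) (gossip tie sel gC r (fun i => best (s i)) d i).
rewrite rs; congr (set_best _ (foldr _ _ (flatten _))).
by apply: eq_map => j; rewrite IH; have [-> _ _ _] := set_bestE (s j)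
  (gossip tie sel gC r (fun i => best (s i)) d j).
Qed.

Lemma run_compute k r s :
  (forall i, current_round (s i) = r) -> at_round k s ->
  at_round k.+1 (fun i => compute i (fun j => w (i, j))
                            (set_best (s i) (round_result r s i))).
Proof.
move=> rs atk i; rewrite mulSn addnC addnS.
by rewrite /= modnMDl modn_small // ltnn (run_exchange _ rs atk).
Qed.

(** Records that the stored matching stays [M] and nobody halts over the rounds of one iteration;
    these are the stuttering steps of the abstract execution. *)
Definition idle M (k k' : nat) : Prop :=
  k < k' /\ forall t, k * D.+1 <= t < k' * D.+1 -> forall i,
    task (run t i) = task_of M i /\ phalted (run t i) = false.

Lemma idle_trans M k k' k'' : idle M k k' -> idle M k' k'' -> idle M k k''.
Proof.
move=> [kk' H] [kk'' H']; split=> [|t /andP[kt tk]]; first exact: ltn_trans kk''.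
have [tk'|k't] := ltnP t (k' * D.+1); first by apply: H; rewrite kt.
by apply: H'; rewrite k't.
Qed.

Lemma idle_round M k r s :
  (forall i, current_round (s i) = r) -> r <> Halted -> at_round k s ->
  (forall i, task (s i) = task_of M i) -> idle M k k.+1.
Proof.
move=> rs rH atk ts; split=> // t /andP[kt]; rewrite mulSn addnC -(subnKC kt) ltn_add2l.
move=> tD i; rewrite (run_exchange _ rs atk) //=.
have [_ -> -> _] := set_bestE (s i)
  (gossip tie sel gC r (fun i => best (s i)) (t - k * D.+1) i).
by rewrite ts rs; case: (r) rH.
Qed.

Definition max_state M i : state :=
  start_max_edge i (fun j => w (i, j)) (task_of M i).

Local Notation bar_task_of M e := (task_of (M :\ e)).
Local Notation bar_edges_of M e := (pruned w setT M :\ e).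

(** The global data [M], [e], [nu], [F] appear in no single agent: each holds its own slice of them,
    besides the shared root and stack. *)
Definition sel_state M e nu F st i : state :=
  start_select i (fun j => w (i, j)) (task_of M i) (bar_task_of M e i)
    [set j | (i, j) \in bar_edges_of M e] (nu i) (i \in F) (Some e.2) st.

Definition ann_state M e nu F st a i : state :=
  start_announce R i (task_of M i) (bar_task_of M e i)
    [set j | (i, j) \in bar_edges_of M e] (nu i) (i \in F) (Some e.2) st a.

Definition cmp_state M e nu F st i : state :=
  start_compare R i (task_of M i) (bar_task_of M e i)
    [set j | (i, j) \in bar_edges_of M e] (nu i) (i \in F) (Some e.2) st.

Definition is_edge_info (x : info R A B) : Prop := exists y, x = EdgeInfo y.

Lemma heaviest_first_linear : linear_order (@heaviest_first R A B tie).
Proof.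
have [anti trans total] := tieP; split.
- move=> [x wx] [y wy]; rewrite /heaviest_first /=.
  case: (ltgtP wx wy) => //= <- /andP[xy yx].
  by rewrite (anti x y) // xy.
- move=> [y wy] [x wx] [z wz]; rewrite /heaviest_first /=.
  case: (ltgtP wx wy) => //= [yx _|->].
    by case/orP=> [zy|/andP[/eqP <- _]]; rewrite ?(lt_trans zy yx) ?yx.
  move=> xy; case: (ltgtP wy wz) => //= _; exact: trans xy.
- move=> [x wx] [y wy]; rewrite /heaviest_first /=.
  by case: (ltgtP wx wy) => //= _; apply: total.
Qed.

Lemma consensus_edges (r : round) (pr : rel (A * B * R)) s k0 y0 :
  linear_order pr ->
  (forall x y, preferred tie sel r (EdgeInfo x) (EdgeInfo y) = pr x y) ->
  (forall i x, best (s i) = Some x -> is_edge_info x) ->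
  best (s k0) = Some (EdgeInfo y0) ->
  exists x, [/\ exists k, best (s k) = Some (EdgeInfo x),
    forall k y, best (s k) = Some (EdgeInfo y) -> pr x y &
    forall i, round_result r s i = Some (EdgeInfo x)].
Proof.
move=> [anti trans total] prE edge b0.
have tot x y : is_edge_info x -> is_edge_info y ->
    preferred tie sel r x y || preferred tie sel r y x.
  by move=> [{}x ->] [{}y ->]; rewrite !prE; apply: total.
have tra y x z : is_edge_info x -> is_edge_info y -> is_edge_info z ->
    preferred tie sel r x y -> preferred tie sel r y z -> preferred tie sel r x z.
  by move=> [{}x ->] [{}y ->] [{}z ->]; rewrite !prE; apply: trans.
have ant k k' x y : best (s k) = Some x -> best (s k') = Some y ->
    preferred tie sel r x y -> preferred tie sel r y x -> x = y.
  move=> /edge[{}x ->] /edge[{}y ->]; rewrite !prE => xy yx.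
  by rewrite (anti x y) // xy.
have [x0 [[k bk] dom res]] := gossip_consensus edge tot tra gC_conn b0 ant.
have [x xE] := edge _ _ bk; rewrite {}xE in bk dom res.
exists x; split=> // [|l y /dom]; [by exists k | by rewrite prE].
Qed.

Lemma max_round M k :
  mcm setT M -> at_round k (max_state M) ->
  exists e, [/\ MaxEdge w M e, idle M k k.+1 &
    at_round k.+1 (sel_state M e [ffun i => bar_task_of M e i] set0 [:: e.2])].
Proof.
move=> mcmM atk; have /andP[mM _] := mcmM.
have rs i : current_round (max_state M i) = MaxEdgeRound by [].
have bestE i x : best (max_state M i) = Some x <->
    exists2 j, (i, j) \in M & x = EdgeInfo (i, j, w (i, j)).
  rewrite /=; case tE: (task_of M i) => [j|]; last first.
    by split=> // -[j]; rewrite -(task_ofP _ _ mM) tE.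
  split=> [[<-]|[j']]; first by exists j; rewrite // -(task_ofP _ _ mM) tE.
  by rewrite -(task_ofP _ _ mM) tE => /eqP[<-] ->.
have edge i x : best (max_state M i) = Some x -> is_edge_info x.
  by move=> /bestE[j _ ->]; eexists.
(* Since there is a task and an MCM covers it, some agent has an edge to offer and the consensus is
   not silent. *)
have [j0 _] : exists j : B, j \in B by apply/existsP; rewrite -[X in is_true X]lt0n.
have [i0 Mij] := mcm_complete_cover j0 leBA mcmM.
have b0 : best (max_state M i0) = Some (EdgeInfo (i0, j0, w (i0, j0))).
  by apply/bestE; exists j0.
have [x [[i /bestE[j Me [xE]]] dom res]] := consensus_edges heaviest_first_linear
  (r := MaxEdgeRound) (fun _ _ => erefl) edge b0.
have maxe : MaxEdge w M (i, j).
  split=> // -[i' j'] Me'; have /dom : best (max_state M i') =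
    Some (EdgeInfo (i', j', w (i', j'))) by apply/bestE; exists j'.
  by rewrite xE /heaviest_first /= => /orP[/ltW//|/andP[/eqP-> _]].
exists (i, j); split=> //; first exact: (idle_round rs).
move=> l; rewrite (run_compute rs atk) res xE /= /sel_state /= ffunE in_set0.
have [mMe _ _ _ _] := mcmD1 leBA mcmM Me.
have -> : (if l == i then None else task_of M l) = task_of (M :\ (i, j)) l.
  have [->|li] := eqVneq l i.
    case tE: task_of => [j'|] //; move/eqP: tE; rewrite (task_ofP _ _ mMe) !inE.
    have [_ inj _] := matchingP _ _ mM.
    by case/andP=> + /(inj _ _ _ Me) jj'; rewrite jj' eqxx.
  rewrite /task_of; apply: eq_pick => j'; rewrite !inE xpair_eqE (negPf li) //.
congr start_select; apply/setP=> j'.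
by rewrite in_set [in RHS]in_set (mem_pruned _ maxe) (task_ofP _ _ mM).
Qed.

(** With no candidate nobody has anything to send, and silence after [D] steps tells every agent
    that the vertex is a dead end. *)
Lemma sel_round_fail M e k nu F t st :
  candidates (bar_edges_of M e) F t = set0 ->
  at_round k (sel_state M e nu F (t :: st)) ->
  idle M k k.+1 /\
  at_round k.+1
    (if e.2 == t then cmp_state M e nu F (t :: st) else
     sel_state M e [ffun i => if bar_task_of M e i == Some t
                              then bar_task_of M e i else nu i] F st).
Proof.
move=> c0 atk.
have rs i : current_round (sel_state M e nu F (t :: st) i) = SelectRound by [].
split=> [|i]; first exact: (idle_round rs).
rewrite (run_compute rs atk) /round_result gossip_none => [|l] /=; last first.
  by have /setP/(_ l) := c0; rewrite [LHS]in_set in_set0 [_ \in [set _ | _]]in_set => ->.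
rewrite (inj_eq Some_inj); case: eqP => // _.
by rewrite /sel_state ffunE.
Qed.

Lemma sel_round_some M e k nu F t st a0 :
  a0 \in candidates (bar_edges_of M e) F t ->
  at_round k (sel_state M e nu F (t :: st)) ->
  exists2 a, a \in candidates (bar_edges_of M e) F t &
    idle M k k.+1 /\ at_round k.+1 (ann_state M e nu F (t :: st) a).
Proof.
move=> a0c atk.
have rs i : current_round (sel_state M e nu F (t :: st) i) = SelectRound by [].
have bestE i : best (sel_state M e nu F (t :: st) i) =
    if i \in candidates (bar_edges_of M e) F t
    then Some (EdgeInfo (i, t, w (i, t))) else None.
  by rewrite /= [_ \in candidates _ _ _]in_set [_ \in [set _ | _]]in_set.
have edge i x : best (sel_state M e nu F (t :: st) i) = Some x -> is_edge_info x.
  by rewrite bestE; case: ifP => // _ [<-]; eexists.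
have b0 : best (sel_state M e nu F (t :: st) a0) = Some (EdgeInfo (a0, t, w (a0, t))).
  by rewrite bestE a0c.
have [x [[a bx] _ res]] := consensus_edges selP (r := SelectRound)
  (fun _ _ => erefl) edge b0.
move: bx; rewrite bestE; case: ifP => // ac [xE].
exists a => //; split=> [|i]; first exact: (idle_round rs).
by rewrite (run_compute rs atk) res -xE.
Qed.

Lemma ann_round M e k nu F t st a :
  at_round k (ann_state M e nu F (t :: st) a) ->
  idle M k k.+1 /\
  at_round k.+1
    (if bar_task_of M e a is Some t' then
       sel_state M e (update nu a (Some t)) (a |: F) (t' :: t :: st)
     else cmp_state M e (update nu a (Some t)) F (t :: st)).
Proof.
move=> atk.
have rs i : current_round (ann_state M e nu F (t :: st) a i) = AnnounceRound by [].
split=> [|i]; first exact: (idle_round rs).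
have b0 : best (ann_state M e nu F (t :: st) a a) =
  Some (TaskInfo R (a, bar_task_of M e a)) by rewrite /= eqxx.
pose b i := best (ann_state M e nu F (t :: st) a i).
(* All items are tied in this round, but only [a] starts with one, so antisymmetry among initial
   items still holds. *)
have [|x [[l bl] _ res]] := @gossip_consensus _ _ _ tie sel gC AnnounceRound b
  (fun=> True) (fun _ _ _ => I) (fun _ _ _ _ => isT) (fun _ _ _ _ _ _ _ _ => isT)
  gC_conn _ _ b0.
  by move=> l l' x y; rewrite /b /=; case: eqP => // -> [<-]; case: eqP => // -> [<-].
have xE : TaskInfo R (a, bar_task_of M e a) = x.
  by move: bl; rewrite /b /=; case: eqP => // -> [].
rewrite (run_compute rs atk) /round_result res -xE /=.
by case: (task_of _ a) => [t'|]; rewrite /sel_state /cmp_state ffunE ?in_setU1.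
Qed.

Lemma cmp_round M e k nu F st :
  at_round k (cmp_state M e nu F st) ->
  idle M k k.+1 /\
  if [exists i, nu i != bar_task_of M e i]
  then at_round k.+1 (max_state (matching_of nu))
  else forall i, task (run (k.+1 * D.+1) i) = task_of M i /\
                 current_round (run (k.+1 * D.+1) i) = Halted.
Proof.
move=> atk.
have rs i : current_round (cmp_state M e nu F st i) = CompareRound by [].
split; first exact: (idle_round rs).
case: ifP => [/existsP[a neq] i|/existsPn eq i].
  have b0 : best (cmp_state M e nu F st a) = Some (TaskInfo R (a, nu a)).
    by rewrite /= neq.
  pose b i := best (cmp_state M e nu F st i).
  (* Agents may end with different items here: the presence of any item is enough to signal a
     change. *)
  have [x res _] := @gossip_best _ _ _ tie sel gC CompareRound b
    (fun=> True) (fun _ _ _ => I) (fun _ _ _ _ => isT) (fun _ _ _ _ _ _ _ _ => isT)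
    gC_conn _ _ i b0.
  rewrite (run_compute rs atk) /round_result res /= /max_state.
  by rewrite task_of_matching_of.
rewrite (run_compute rs atk) /round_result gossip_none //= => l.
by rewrite (negPf (eq l)).
Qed.

(** The measure [2 * #|~: F| + size st] decreases at each move: exploring an agent removes 2 and
    pushes 1, backtracking pops 1. *)
Lemma search_run M e : mcm setT M -> e \in M ->
  forall n k nu F t st, 2 * #|~: F| + size st < n ->
  chain e.2 (bar_task_of M e) (bar_edges_of M e) t st nu ->
  search_invariant (bar_task_of M e) (bar_edges_of M e) F nu ->
  at_round k (sel_state M e nu F (t :: st)) ->
  exists k' nu' F' st',
    [/\ idle M k k', search e.2 (bar_task_of M e) (bar_edges_of M e) F nu t nu' &
        at_round k' (cmp_state M e nu' F' st')].
Proof.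
move=> mcmM Me; have [mMe m_inj m_root m_cover m_edge] := mcmD1 leBA mcmM Me.
have m_edge' a j (ma : bar_task_of M e a = Some j) :
  (a, j) \in bar_edges_of M e := subsetP (subset_pruned w M e) _ (m_edge _ _ ma).
elim=> [//|n IH] k nu F t st; rewrite ltnS => len c inv atk.
have [c0|[a0 a0c]] := set_0Vmem (candidates (bar_edges_of M e) F t).
  have [id atk1] := sel_round_fail c0 atk; move: atk1; rewrite eq_sym.
  have [tE|tr] := eqVneq t e.2 => atk1.
    exists k.+1, nu, F, (t :: st); split=> //.
    by rewrite tE; apply: SearchFail; rewrite -tE.
  have [a ma] := m_cover _ tr.
  have [t' [st' [stE nua c']]] := chain_pop m_inj c tr ma.
  (* Locally, each agent whose old task is [t] resets its pointer; injectivity makes [a] the only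
     such agent. *)
  have nuE : [ffun i => if bar_task_of M e i == Some t then bar_task_of M e i
                        else nu i] = update nu a (bar_task_of M e a).
    apply/ffunP=> i; rewrite !ffunE; have [->|ia] := eqVneq i a.
      by rewrite ma eqxx.
    by case: eqP => // mi; rewrite (m_inj _ _ _ mi ma) eqxx in ia.
  rewrite {}nuE stE in atk1; rewrite {}stE in len.
  have [|k' [nu' [F' [st'' [id' se at']]]]] :=
    IH _ _ _ _ _ _ c' (search_invariant_backtrack inv c0 ma) atk1.
    by rewrite /= addnS in len.
  exists k', nu', F', st''; split=> //; first exact: idle_trans id id'.
  exact: SearchBacktrack c0 tr ma nua se.
have [a ac [id atk1]] := sel_round_some a0c atk.
have [id1 atk2] := ann_round atk1; have {id1}id := idle_trans id id1.
case ma: (bar_task_of M e a) atk2 => [t'|] atk2; last first.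
  by exists k.+2, (update nu a (Some t)), F, (t :: st); split=> //; apply: SearchFree.
have c' : chain e.2 (bar_task_of M e) (bar_edges_of M e) t' (t :: st)
    (update nu a (Some t)).
  move: (ac); rewrite in_set => /andP[aF Eat].
  by apply: ChainPush c Eat _ ma; rewrite inv.1.
have inv' := search_invariant_explore m_inj m_root m_cover m_edge' c inv ac ma.
have [|k' [nu' [F' [st'' [id' se at']]]]] := IH _ _ _ _ _ _ c' inv' atk2.
  move: ac; rewrite in_set => /andP[aF _].
  have cF : #|~: F| = #|~: (a |: F)|.+1.
    rewrite (cardsD1 a) in_setC aF add1n; congr _.+1; apply: eq_card => i.
    by rewrite !inE negb_or.
  by rewrite (leq_trans _ len) // cF mulnS /= add2n addSnnS.
exists k', nu', F', st''; split=> //; first exact: idle_trans id id'.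
exact: SearchMatched ac ma se.
Qed.

Lemma halted_step t i : current_round (run t i) = Halted ->
  current_round (run t.+1 i) = Halted /\ task (run t.+1 i) = task (run t i).
Proof.
move=> rH /=; case: ifP => _; last first.
  by case: (run t i) rH => m mb E v F rt st r [[?|?]|] /= ->.
rewrite exchangeE; set b := foldr _ _ _.
by have [_ -> -> _] := set_bestE (run t i) b.
Qed.

Lemma halted_forever t0 t i : current_round (run t0 i) = Halted -> t0 <= t ->
  current_round (run t i) = Halted /\ task (run t i) = task (run t0 i).
Proof.
move=> rH /subnKC <-; elim: (t - t0) => [|d [IHr IHt]]; first by rewrite addn0.
by have [r_ t_] := halted_step IHr; rewrite addnS r_ t_ IHt.
Qed.

Lemma stored_matchingE t M : matching setT M ->
  (forall i, task (run t i) = task_of M i) -> stored_matching P gC w M0 t = M.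
Proof.
by move=> mM tM; rewrite -[RHS](matching_of_task_of mM); apply: eq_matching_of.
Qed.

(** Induction on a bound [n] for the size of the pruned graph, one full iteration at a time,
    starting from the beginning of a MaxEdge round. *)
Lemma pruneBAP_run n k M (stored := stored_matching P gC w M0) :
  mcm setT M -> #|pruned w setT M| < n -> at_round k (max_state M) ->
  exists T, [/\ k * D.+1 <= T,
    forall t, k * D.+1 <= t < T ->
      stored t.+1 = stored t \/ prune_continues w (stored t) (stored t.+1),
    prune_returns w (stored T) /\ mcm setT (stored T),
    forall t, T <= t -> stored t = stored T &
    forall t i, k * D.+1 <= t -> phalted (run t i) = (T <= t)].
Proof.
elim: n k M => [//|n IH] k M mcmM; rewrite ltnS => len atk.
have /andP[mM _] := mcmM.
have [e [maxe id atk1]] := max_round mcmM atk; have Me := maxe.1.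
have [k2 [nu [F [st [id2 se at2]]]]] := search_run mcmM Me (ltnSn _)
  (ChainRoot _ _ _) (search_invariant0 _ _) atk1.
have [id3 at3] := cmp_round at2.
have {id id2 id3}id := idle_trans (idle_trans id id2) id3.
have [mMe _ _ _ _] := mcmD1 leBA mcmM Me.
have aug : AugDFS e (M :\ e) (bar_edges_of M e) (matching_of nu).
  by exists nu.
have [kk idM] := id.
have storedM t : k * D.+1 <= t < k2.+1 * D.+1 -> stored t = M.
  by move=> /idM tM; apply: stored_matchingE => // i; have [] := tM i.
have kk3 : k * D.+1 <= k2.+1 * D.+1 by rewrite leq_mul2r ltnW ?orbT.
case: existsP at3 => [[a neq] at3|eq haltP].
  have cont : prune_continues w M (matching_of nu).
    exists e; split=> // nuE; case/eqP: neq.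
    by rewrite -nuE task_of_matching_of.
  have [mcm' lt'] := prune_continues_mcm leBA mcmM cont.
  have [T [kT step ret fin halt]] := IH _ _ mcm' (leq_trans lt' len) at3.
  have stored3 : stored (k2.+1 * D.+1) = matching_of nu.
    by have /andP[mm _] := mcm'; apply: stored_matchingE => // i; rewrite at3.
  exists T; split=> // [|t /andP[kt tT]|t i kt]; first exact: leq_trans kT.
    have [tk|kt'] := ltnP t.+1 (k2.+1 * D.+1).
      by left; rewrite !storedM // ?kt ?(ltnW tk) // (leq_trans kt).
    (* The stored matching changes exactly at the last step of the compare round, when [t.+1] is the
       start of the next iteration. *)
    move: kt'; rewrite leq_eqVlt => /predU1P[tE|kt'].
      by right; rewrite -tE stored3 storedM // kt tE leqnn.
    by apply: step; rewrite -ltnS kt'.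
  have [tk|kt'] := ltnP t (k2.+1 * D.+1); last exact: halt.
  have /idM/(_ i)[_ ->] : k * D.+1 <= t < k2.+1 * D.+1 by rewrite kt.
  by rewrite leqNgt (leq_trans tk kT).
(* No agent saw a change, so the search returned [M :\ e], which is the stopping test of
   pruneBAP. *)
have nuE : matching_of nu = M :\ e.
  rewrite -[RHS](matching_of_task_of mMe); apply: eq_matching_of => i.
  by apply/eqP/negPn/negP => neq; case: eq; exists i.
have storedT t : k2.+1 * D.+1 <= t -> stored t = M.
  move=> kt; apply: stored_matchingE => // i; have [tM rH] := haltP i.
  by have [_ ->] := halted_forever rH kt.
exists (k2.+1 * D.+1); split=> // [t /andP[kt tk]||t kt|t i kt].
- left; rewrite [stored t]storedM ?kt //.
  have [tk'|kt'] := ltnP t.+1 (k2.+1 * D.+1); last exact: storedT.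
  by rewrite storedM // tk' (leq_trans kt).
- by rewrite storedT //; split=> //; exists e; rewrite -{2}nuE.
- by rewrite !storedT.
- have [tk|kt'] := ltnP t (k2.+1 * D.+1).
    by have /idM/(_ i)[_ ->] : k * D.+1 <= t < k2.+1 * D.+1 by rewrite kt.
  by have [_ rH] := haltP i; rewrite /= (halted_forever rH kt').1.
Qed.

End Distributed.

Theorem theorem1 (R : realType) (A B : finType)
    (B_gt0 : (1 <= #|B|)%N) (leBA : (#|B| <= #|A|)%N)
    (w : A * B -> R)
    (gC : rel A) (gC_sym : symmetric gC) (gC_irr : irreflexive gC)
    (gC_conn : forall i k, connect gC i k)
    (tie : rel (A * B)) (tieP : linear_order tie)
    (sel : rel (A * B * R)) (selP : linear_order sel)
    (M0 : {set A * B}) (M0P : mcm [set: A * B] M0) :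
  let P := distributed_pruneBAP (diameter gC) tie sel in
  let M := stored_matching P gC w M0 in
  exists T : nat,
    [/\ pruneBAP_execution w M0 M T,
        forall (t : nat) (i : A), phalted (run P gC w M0 t i) = (T <= t)%N,
        mcm [set: A * B] (M T) &
        max_weight w (M T) =
          (\big[mine/+oo]_(M' : {set A * B} | mcm [set: A * B] M')
             max_weight w M')%E].
Proof.
move=> P M; have /andP[mM0 _] := M0P.
(* Agents are initialised directly in the state that opens a MaxEdge round, so time 0 starts the
   first iteration. *)
have at0 : at_round w gC tie sel M0 0 (max_state w M0) by [].
have [T [_ step [ret mcmT] fin halt]] :=
  pruneBAP_run B_gt0 leBA gC_conn tieP selP M0P (ltnSn _) at0.
exists T; split=> // [|t i|]; [| exact: halt | exact: prune_returns_optimal].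
by split=> //; apply: matching_of_task_of mM0.
Qed.
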